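(* Let $\Lambda$ be a finite $k$-graph, possibly with sources. Let $r\in(0,\infty)^k$ and let $\beta$ be such that $\beta r_i>\ln\rho(A_i)$ for $1\le i\le k$. Then for $\epsilon\in\Sigma_\beta$, the KMS$_\beta$ state $\phi_\epsilon$ of $(\mathcal{T}C^*(\Lambda),\alpha^r)$ factors through a state of $C^*(\Lambda)$ if and only if $\epsilon$ is supported on the set of absolute sources.
   Context: A $k$-graph is a countable category $\Lambda$ with a functor $d:\Lambda\to\mathbb{N}^k$ such that whenever $d(\lambda)=n+p$ there are unique $\mu,\nu\in\Lambda$ with $d(\mu)=n$, $d(\nu)=p$ and $\lambda=\mu\nu$. Write $\Lambda^n=d^{-1}(n)$; $\Lambda^0$ is identified with the set of objects (vertices), $r,s:\Lambda\to\Lambda^0$ are the codomain and domain maps, and $\lambda\mu$ is defined when $s(\lambda)=r(\mu)$. For $v,w\in\Lambda^0$, $v\Lambda^nw=\{\lambda\in\Lambda^n:r(\lambda)=v,\ s(\lambda)=w\}$, and similarly for $v\Lambda^n$, $v\Lambda$, $\Lambda v$. $\Lambda$ is finite if every $\Lambda^n$ is finite. With $e_1,\dots,e_k$ the usual basis of $\mathbb{N}^k$, the vertex matrices are $A_i(v,w)=|v\Lambda^{e_i}w|$; $\rho$ denotes spectral radius (with $\ln0=-\infty$). A vertex $v$ is an absolute source if $v\Lambda=\{v\}$. For $\mu,\nu\in\Lambda$ with $r(\mu)=r(\nu)$, $\Lambda^{\min}(\mu,\nu)=\{(\eta,\zeta):\mu\eta=\nu\zeta,\ d(\mu\eta)=d(\mu)\vee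 d(\nu)\}$; it is empty if $r(\mu)\neq r(\nu)$. $\mathcal{T}C^*(\Lambda)$ is the $C^*$-algebra generated by a universal family of partial isometries $\{t_\lambda:\lambda\in\Lambda\}$ such that: the $q_v:=t_v$ ($v\in\Lambda^0$) are mutually orthogonal projections; $t_\lambda t_\mu=t_{\lambda\mu}$ if $s(\lambda)=r(\mu)$; $t_\lambda^*t_\lambda=q_{s(\lambda)}$; $q_v\ge\sum_{\lambda\in v\Lambda^n}t_\lambda t_\lambda^*$ for all $v,n$ (empty sums are $0$); and $t_\mu^*t_\nu=\sum_{(\eta,\zeta)\in\Lambda^{\min}(\mu,\nu)}t_\eta t_\zeta^*$. The dynamics is $\alpha^r_t(t_\lambda)=e^{it\,r\cdot d(\lambda)}t_\lambda$. A state $\phi$ is a KMS$_\beta$ state ($\beta\in(0,\infty)$) of $(A,\alpha)$ if $\phi(ab)=\phi(b\,\alpha_{i\beta}(a))$ for all $a,b$ in a dense $\alpha$-invariant subalgebra of analytic elements. Put $\Lambda^1=\bigcup_{i=1}^k\Lambda^{e_i}$. A subset $E\subset v\Lambda^1$ is exhaustive if every $\lambda\in v\Lambda$ with $d(\lambda)\ne0$ has $\Lambda^{\min}(\lambda,e)\neq\emptyset$ for some $e\in E$. The graph algebra $C^*(\Lambda)$ is the quotient of $\mathcal{T}C^*(\Lambda)$ by the ideal generated by the projections $\prod_{e\in E}(q_v-t_et_e^* )$ for all $v\in\Lambda^0$ and all nonempty exhaustive $E\subset v\Lambda^1$ (so no relation is imposed at absolute sources). A state factors through $C^*(\Lambda)$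 if it vanishes on this ideal. For $\beta r_i>\ln\rho(A_i)$ ($1\le i\le k$), set $y^\beta_v=\sum_{\mu\in\Lambda v}e^{-\beta r\cdot d(\mu)}<\infty$ and $\Sigma_\beta=\{\epsilon\in[0,\infty)^{\Lambda^0}:\epsilon\cdot y^\beta=1\}$. Let $\{h_\lambda:\lambda\in\Lambda\}$ be the usual orthonormal basis of $\ell^2(\Lambda)$ and let $\pi:\mathcal{T}C^*(\Lambda)\to B(\ell^2(\Lambda))$ be the finite-path representation, $\pi(t_\mu)h_\lambda=h_{\mu\lambda}$ if $s(\mu)=r(\lambda)$ and $0$ otherwise. For $\epsilon\in\Sigma_\beta$ the state $\phi_\epsilon$ is $$\phi_\epsilon(a)=\sum_{\lambda\in\Lambda}e^{-\beta r\cdot d(\lambda)}\epsilon_{s(\lambda)}\,(\pi(a)h_\lambda\,|\,h_\lambda).$$ It is known that $\epsilon\mapsto\phi_\epsilon$ is an affine bijection of $\Sigma_\beta$ onto the KMS$_\beta$ states of $(\mathcal{T}C^*(\Lambda),\alpha^r)$. *)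

(* Defs.v *)
From HB Require Import structures.
From mathcomp Require Import all_boot all_order all_algebra finmap.
From mathcomp Require Import all_classical all_reals all_analysis.
From mathcomp Require Import complex.
From mathcomp.analysis.showcase Require summability.

Set Implicit Arguments.
Unset Strict Implicit.
Unset Printing Implicit Defensive.
Import Order.TTheory GRing.Theory Num.Theory numFieldNormedType.Exports.
Local Open Scope classical_set_scope.
Local Open Scope ring_scope.
Local Open Scope complex_scope.

(* Objects [V] and morphisms [L] are separate types. [comp l m] is the composite
   of [l] and [m] in the order of the paths, meaningful only if
   [src l = rng m] and unspecified otherwise. The vertex [v] as an element of
   [deg @^-1` [set 0]] is [idp v]. *)
Record kgraph (k : nat) (V L : countType) := KGraph {
  src : L -> V;
  rng : L -> V;
  idp : V -> L;
  comp : L -> L -> L;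
  deg : L -> {ffun 'I_k -> nat};
  src_idp : forall v, src (idp v) = v;
  rng_idp : forall v, rng (idp v) = v;
  src_comp : forall l m, src l = rng m -> src (comp l m) = src m;
  rng_comp : forall l m, src l = rng m -> rng (comp l m) = rng l;
  comp_idl : forall l, comp (idp (rng l)) l = l;
  comp_idr : forall l, comp l (idp (src l)) = l;
  compA : forall l m n, src l = rng m -> src m = rng n ->
    comp l (comp m n) = comp (comp l m) n;
  deg_idp : forall v, deg (idp v) = 0;
  deg_comp : forall l m, src l = rng m -> deg (comp l m) = deg l + deg m;
  factorization : forall l n p, deg l = n + p ->
    exists! mn : L * L,
      [/\ src mn.1 = rng mn.2, deg mn.1 = n, deg mn.2 = p
        & l = comp mn.1 mn.2]
}.

Section HigherRankGraph.
Context (k : nat) (V L : countType) (G : kgraph k V L).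
Implicit Types (l m n e : L) (v w : V).

Definition finite_kgraph := forall p, finite_set [set l | deg G l = p].

Definition unit_deg (i : 'I_k) : {ffun 'I_k -> nat} :=
  [ffun j => (i == j : nat)].

Definition join_deg (p q : {ffun 'I_k -> nat}) : {ffun 'I_k -> nat} :=
  [ffun i => maxn (p i) (q i)].

Definition absolute_source v := [set l | rng G l = v] = [set idp G v].

Definition Lmin m n : set (L * L) :=
  [set x | [/\ rng G m = rng G n, src G m = rng G x.1, src G n = rng G x.2,
              comp G m x.1 = comp G n x.2
            & deg G (comp G m x.1) = join_deg (deg G m) (deg G n)]].

Definition edges v : set L :=
  [set e | rng G e = v /\ exists i, deg G e = unit_deg i].

(* Subsets of [edges v] are given by enumerations, since they are finite when
   [G] is. *)
Definition exhaustive v (E : seq L) :=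
  [set` E] `<=` edges v /\
  forall l, rng G l = v -> deg G l != 0 ->
    exists2 e, e \in E & Lmin l e !=set0.

End HigherRankGraph.

Definition vertex_matrix (R : realType) (k : nat) (V : finType) (L : countType)
    (G : kgraph k V L) (i : 'I_k) : 'M[R[i]]_#|V| :=
  \matrix_(a, b)
    (#|` fset_set [set l | [/\ deg G l = unit_deg i, rng G l = enum_val a
                             & src G l = enum_val b] ] |)%:R.

Definition spectral_radius (R : realType) (n : nat) (M : 'M[R[i]]_n) : R :=
  sup [set x : R | exists2 z : R[i], eigenvalue M z & `|z| = x%:C].

(* Complex C*-algebras, not assumed to have a unit. *)
Record cstar_algebra (R : realType) := CStarAlgebra {
  cstar_sort :> completeNormedModType R[i];
  cmul : cstar_sort -> cstar_sort -> cstar_sort;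
  cstar : cstar_sort -> cstar_sort;
  cmulA : forall a b c, cmul a (cmul b c) = cmul (cmul a b) c;
  cmulPl : forall (x : R[i]) a b c,
    cmul (x *: a + b) c = x *: cmul a c + cmul b c;
  cmulPr : forall (x : R[i]) a b c,
    cmul c (x *: a + b) = x *: cmul c a + cmul c b;
  cstarK : forall a, cstar (cstar a) = a;
  cstarP : forall (x : R[i]) a b,
    cstar (x *: a + b) = x^* *: cstar a + cstar b;
  cstarM : forall a b, cstar (cmul a b) = cmul (cstar b) (cstar a);
  cmul_norm : forall a b, `|cmul a b| <= `|a| * `|b|;
  cstar_norm : forall a, `|cmul (cstar a) a| = `|a| ^+ 2
}.

Notation "a ⋅ b" := (cmul a b) (at level 40, left associativity) : ring_scope.
Notation "a ^†" := (cstar a) (at level 2, format "a ^†") : ring_scope.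

Section CStar.
Context (R : realType).
Implicit Types (A B : cstar_algebra R).

Definition cstar_le A (a b : A) := exists c : A, b - a = c^† ⋅ c.

Definition star_hom A B (f : A -> B) :=
  [/\ forall (x : R[i]) a b, f (x *: a + b) = x *: f a + f b,
      forall a b, f (a ⋅ b) = f a ⋅ f b
    & forall a, f a^† = (f a)^†].

Definition closed_star_subalgebra A (D : set A) :=
  [/\ D 0, forall (x : R[i]) a b, D a -> D b -> D (x *: a + b),
      forall a b, D a -> D b -> D (a ⋅ b), forall a, D a -> D a^†
    & closed D].

Definition closed_ideal A (J : set A) :=
  [/\ J 0, forall (x : R[i]) a b, J a -> J b -> J (x *: a + b),
      forall a b, J a -> J (b ⋅ a), forall a b, J a -> J (a ⋅ b)
    & closed J].

Definition ideal_generated A (S : set A) : set A :=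
  [set a | forall J, closed_ideal J -> S `<=` J -> J a].

End CStar.

Section GraphAlgebras.
Context (R : realType) (k : nat) (V L : countType) (G : kgraph k V L).

(* The sums over paths are meant for finite [G]: [\sum_(_ \in _)] is the finite
   sum over a set on which the summand has finite support. *)
Record toeplitz_family (A : cstar_algebra R) (t : L -> A) : Prop := {
  tf_partial_isometry : forall l, t l ⋅ (t l)^† ⋅ t l = t l;
  tf_projection : forall v,
    t (idp G v) ⋅ t (idp G v) = t (idp G v) /\
    (t (idp G v))^† = t (idp G v);
  tf_orthogonal : forall v w, v <> w -> t (idp G v) ⋅ t (idp G w) = 0;
  tf_mul : forall l m, src G l = rng G m -> t l ⋅ t m = t (comp G l m);
  tf_source : forall l, (t l)^† ⋅ t l = t (idp G (src G l));
  tf_range : forall v p,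
    cstar_le
      (\sum_(l \in [set l | rng G l = v /\ deg G l = p]) t l ⋅ (t l)^†)
      (t (idp G v));
  tf_min : forall m n,
    (t m)^† ⋅ t n = \sum_(x \in Lmin G m n) t x.1 ⋅ (t x.2)^†
}.

(* This determines the pair [(A, t)] up to a unique isomorphism. *)
Record toeplitz_algebra (A : cstar_algebra R) (t : L -> A) : Prop := {
  ta_family : toeplitz_family t;
  ta_generated : forall D : set A,
    closed_star_subalgebra D -> range t `<=` D -> D = setT;
  ta_universal : forall (B : cstar_algebra R) (s : L -> B),
    toeplitz_family s ->
    exists2 f : A -> B, star_hom f & forall l, f (t l) = s l
}.

(* The product of the [q_v - t_e t_e^*], [e] in [E]. For a nonempty
   [E] included in [edges G v] the initial factor [q_v] is redundant, and by
   [tf_min] the factors are commuting projections when [G] is finite, so that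
   neither the order nor repetitions in [E] matter. *)
Definition gap_projection (A : cstar_algebra R) (t : L -> A) (v : V)
    (E : seq L) : A :=
  foldr (fun e p => (t (idp G v) - t e ⋅ (t e)^†) ⋅ p) (t (idp G v)) E.

Definition graph_ideal (A : cstar_algebra R) (t : L -> A) : set A :=
  ideal_generated
    [set p | exists v E, [/\ E != [::], exhaustive G v E
                           & p = gap_projection t v E] ].

Definition factors_through_graph_algebra (A : cstar_algebra R) (t : L -> A)
    (phi : A -> R[i]) :=
  forall a, graph_ideal t a -> phi a = 0.

End GraphAlgebras.

Section FinitePathRepresentation.
Context (R : realType) (H : completeNormedModType R[i])
        (ip : {dot H for (@Num.conj R[i])}).

Definition is_hilbert := forall x : H, `|x| ^+ 2 = ip x x.

(* Together with [is_hilbert] this says that [H] is, up to a unitary, [l^2(I)]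
   with its usual basis. *)
Definition orthonormal_basis (I : choiceType) (h : I -> H) :=
  (forall i j, ip (h i) (h j) = (i == j)%:R) /\
  (forall D : set H,
     [/\ D 0, forall (x : R[i]) a b, D a -> D b -> D (x *: a + b)
       & closed D] ->
     range h `<=` D -> D = setT).

(* [A -> B(H)] without a type of bounded operators; [rep_star] makes
   [pi a^†] the Hilbert-space adjoint of [pi a]. *)
Record representation (A : cstar_algebra R) (pi : A -> H -> H) : Prop := {
  rep_operator : forall a (x : R[i]) y z,
    pi a (x *: y + z) = x *: pi a y + pi a z;
  rep_bounded : forall a, exists M : R[i], forall y, `|pi a y| <= M * `|y|;
  rep_linear : forall (x : R[i]) a b y,
    pi (x *: a + b) y = x *: pi a y + pi b y;
  rep_mul : forall a b y, pi (a ⋅ b) y = pi a (pi b y);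
  rep_star : forall a y z, ip (pi a^† y) z = ip y (pi a z)
}.

Definition finite_path_representation (k : nat) (V L : countType)
    (G : kgraph k V L) (h : L -> H) (A : cstar_algebra R) (t : L -> A)
    (pi : A -> H -> H) :=
  representation pi /\
  forall m l, pi (t m) (h l) =
    if src G m == rng G l then h (comp G m l) else 0.

End FinitePathRepresentation.

Section KMSStates.
Context (R : realType) (k : nat) (V : finType) (L : countType)
        (G : kgraph k V L) (r : 'I_k -> R) (beta : R).

Definition boltzmann (l : L) : R :=
  expR (- beta * \sum_i r i * (deg G l i)%:R).

Definition partition_vector (v : V) : \bar R :=
  \esum_(l in [set l | src G l = v]) (boltzmann l)%:E.

Definition Sigma_beta (eps : V -> R) :=
  (forall v, 0 <= eps v) /\
  (\sum_v (eps v)%:E * partition_vector v)%E = 1%:E.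

(* [summability.sum] is the limit of the partial sums along the finite subsets
   of [L]; the family below is absolutely summable if [Sigma_beta eps]. The
   KMS property of [phi_state] for the dynamics
   [t_l |-> e^(i s (r . deg l)) t_l] is a theorem about this formula, hence the
   dynamics does not appear in it. *)
Definition phi_state (H : completeNormedModType R[i])
    (ip : {dot H for (@Num.conj R[i])}) (h : L -> H)
    (A : cstar_algebra R) (pi : A -> H -> H) (eps : V -> R) (a : A) : R[i] :=
  @summability.sum L R[i] (R[i]^o)
    (fun l => (boltzmann l * eps (src G l))%:C * ip (pi a (h l)) (h l)).

End KMSStates.

(* Main.v *)
Require Import Defs.
From HB Require Import structures.
From mathcomp Require Import all_boot all_order all_algebra finmap.
From mathcomp Require Import all_classical all_reals all_analysis.
From mathcomp Require Import complex ring.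

Set Implicit Arguments.
Unset Strict Implicit.
Unset Printing Implicit Defensive.
Import Order.TTheory GRing.Theory Num.Theory numFieldNormedType.Exports.
Local Open Scope ring_scope.

(** Let [K] be the closed linear span in the Toeplitz algebra of the [t_l] for
    which the source of [l] is an absolute source. Such a path [l] has no proper
    extension, so the relation for [t_n^* t_l] expresses this element by
    paths with the same source; hence [K] is a closed left ideal
    ([span_ideal]), and its left annihilator is a closed two-sided ideal. If [E]
    is a nonempty exhaustive set of edges at [v], then a path from [v] to an
    absolute source is not the vertex [v], since [v] has edges, and starts with
    an edge [e] of [E] because it cannot be extended. As
    [(q_v - t_e t_e^* ) t_l = 0], the gap projection of [E] annihilates [K].
    Therefore the whole graph ideal annihilates [K]
    ([graph_ideal_absolute_source]). When [eps] lives on the absolute sources,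
    every term of nonzero weight in the series for [phi_eps (a)] contains
    [pi a h_l = pi (a t_l) h_(s(l))] with [t_l] in [K], which is 0 for [a] in
    the graph ideal. Inside the algebra, all closedness arguments follow from the
    submultiplicativity of the norm and the isometry of the involution.

    Conversely, if [v] is not an absolute source then the finite set of all
    edges at [v] is nonempty and exhaustive. In the finite-path representation
    its gap projection is diagonal with entries 0 and 1
    ([rep_gap_projection]), and its entry at the vertex [v] is 1. The series
    for its value under [phi_eps] has nonnegative terms and bounded partial sums
    ([Sigma_beta_sum]), so it can vanish only if each term does
    ([sum_nneg_eq0]); the term at [v] is [eps v]. *)

(** * Paths *)

Section Paths.
Local Open Scope classical_set_scope.
Local Open Scope ring_scope.
Context (k : nat) (V L : countType) (G : kgraph k V L).
Implicit Types (l m n e : L) (v w : V).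

Definition starts_with e l :=
  exists2 l', src G e = rng G l' & l = Defs.comp G e l'.

(** Unique factorization makes every path left cancellable. *)
Lemma comp_injr m i j : src G m = rng G i -> src G m = rng G j ->
  Defs.comp G m i = Defs.comp G m j -> i = j.
Proof.
move=> mi mj ij.
have dij : deg G i = deg G j.
  have := congr1 (deg G) ij; rewrite !deg_comp // => d.
  apply/ffunP => x; move: (congr1 (fun f : {ffun 'I_k -> nat} => f x) d).
  by rewrite !ffunE => /addnI.
have [p [_ up]] := factorization (deg_comp mi).
have pi : p = (m, i) by apply: up.
have pj : p = (m, j) by apply: up.
by move: pj; rewrite pi => -[].
Qed.

(** [idp (rng l) l] and [l idp (src l)] factor [l] with the same degrees. *)
Lemma deg0_idp l : deg G l = 0 -> l = idp G (rng G l).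
Proof.
move=> l0.
have [p [_ up]] := @factorization k V L G l 0 0 (etrans l0 (esym (addr0 0))).
have e1 : p = (idp G (rng G l), l).
  by apply: up; split => //; rewrite ?src_idp ?deg_idp ?comp_idl.
have e2 : p = (l, idp G (src G l)).
  by apply: up; split => //; rewrite ?rng_idp ?deg_idp ?comp_idr.
by move: e2; rewrite e1 => -[].
Qed.

Lemma starts_with_edge l : deg G l != 0 ->
  exists2 e, edges G (rng G l) e & starts_with e l.
Proof.
move=> l0.
have [i li] : exists i, deg G l i != 0%N.
  apply/existsP; apply: contraR l0; rewrite negb_exists => /forallP l0.
  by apply/eqP/ffunP => x; rewrite ffunE; apply/eqP/negPn.
have dE : deg G l = unit_deg i + [ffun x => deg G l x - (i == x)]%N.
  apply/ffunP => x; rewrite !ffunE -[RHS]/(_ + _)%N; case: eqP => [<-|_] /=.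
    by rewrite subnKC // lt0n.
  by rewrite add0n subn0.
have [[e l'] [[el de _ ->] _]] := factorization dE; rewrite /= in el de *.
exists e; last by exists l'.
by split; [rewrite rng_comp|exists i].
Qed.

Lemma absolute_sourceP v :
  absolute_source G v <-> forall l, rng G l = v -> l = idp G v.
Proof.
split=> [av l lv|h].
  by move: lv; rewrite -[rng G l = v]/([set l | rng G l = v] l) av.
by apply/seteqP; split=> [l /h //|l ->]; rewrite /= rng_idp.
Qed.

Lemma absolute_source_edges v : absolute_source G v -> edges G v = set0.
Proof.
move=> /absolute_sourceP av; apply/seteqP; split=> // e [/av ->].
by case=> i; rewrite deg_idp => /ffunP/(_ i); rewrite !ffunE eqxx.
Qed.

(** A path that ends at an absolute source is maximal for the prefix order, so
    a common extension of it with another path is that path itself. *)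
Lemma Lmin_absolute_source l n x : absolute_source G (src G l) ->
  Lmin G n l x -> x.2 = idp G (src G l) /\ l = Defs.comp G n x.1.
Proof.
move=> /absolute_sourceP av [_ _ lx nx _].
have x2 : x.2 = idp G (src G l) by exact: av.
by split=> //; rewrite nx x2 comp_idr.
Qed.

Lemma Lmin_starts_with e l : starts_with e l -> Lmin G l e !=set0.
Proof.
move=> [l' el ->]; exists (idp G (src G (Defs.comp G e l')), l').
split=> //=; rewrite ?rng_idp ?rng_comp ?comp_idr //.
apply/ffunP => i; rewrite !ffunE; apply/esym/maxn_idPl.
by rewrite deg_comp // !ffunE leq_addr.
Qed.

Lemma exhaustive_edges v (E : seq L) : [set` E] = edges G v ->
  exhaustive G v E.
Proof.
move=> EE; split=> [|l lv l0]; first by rewrite EE.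
have [e ev el] := starts_with_edge l0.
exists e; last exact: Lmin_starts_with.
by have : [set` E] e by rewrite EE -lv.
Qed.

Lemma finite_edges v : finite_kgraph G -> finite_set (edges G v).
Proof.
move=> Gfin.
have fin : finite_set
    (\bigcup_(i in [set: 'I_k]) [set l | deg G l = unit_deg i]).
  by apply: bigcup_finite => // i _; exact: Gfin.
by apply: sub_finite_set fin => e [_ [i ei]]; exists i.
Qed.

(** A common extension of [l] with an edge of [E] can only be [l]. *)
Lemma starts_with_edge_absolute_source l v (E : seq L) :
  absolute_source G (src G l) -> exhaustive G v E -> E != [::] ->
  rng G l = v -> exists2 e, e \in E & starts_with e l.
Proof.
move=> av [Ev Eex] E0 lv.
have l0 : deg G l != 0.
  (* otherwise v is the absolute source and has no edges for E to contain *)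
  apply/negP => /eqP/deg0_idp lE.
  have sv : src G l = v by rewrite lE src_idp.
  case: E E0 Ev {Eex} => // e E _ Ev.
  have : edges G v e by apply: Ev; rewrite /= mem_head.
  by rewrite absolute_source_edges // -sv.
have [e eE [x lx]] := Eex l lv l0; exists e => //.
have [x1 x2 x3 x4 _] := lx.
exists x.2 => //; rewrite -x4.
by have /absolute_sourceP/(_ _ (esym x2)) -> := av; rewrite comp_idr.
Qed.

End Paths.

(** * Closed sets and bounded linear maps *)

Section Closed.
Local Open Scope classical_set_scope.
Local Open Scope ring_scope.

Lemma preimage_closed_bounded (K : numFieldType) (U W : normedModType K)
    (f : U -> W) (C : K) (D : set W) :
  0 <= C -> (forall x y, f (x - y) = f x - f y) ->
  (forall x, `|f x| <= C * `|x|) -> closed D -> closed (f @^-1` D).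
Proof.
move=> C0 fB fC; apply: preimage_closed => x _.
apply/(@cvgrPdist_lt K W) => e e0.
have C1 : 0 < C + 1 by rewrite ltr_wpDl.
near=> y; rewrite -fB; apply: le_lt_trans (fC _) _.
apply: (@le_lt_trans _ _ ((C + 1) * `|x - y|)).
  by rewrite ler_wpM2r // lerDl.
rewrite -ltr_pdivlMl //; near: y; apply: cvgr_dist_lt => //.
by rewrite mulr_gt0 // invr_gt0.
Unshelve. all: by end_near. Qed.

Lemma closed_preimage0_bounded (K : numFieldType) (U W : normedModType K)
    (f : U -> W) (C : K) :
  0 <= C -> (forall x y, f (x - y) = f x - f y) ->
  (forall x, `|f x| <= C * `|x|) -> closed [set x | f x = 0].
Proof.
move=> C0 fB fC.
apply: (preimage_closed_bounded C0 fB fC (D := [set 0])).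
exact/accessible_closed_set1/hausdorff_accessible/norm_hausdorff.
Qed.

Lemma fsbig_closed (U : nmodType) (I : choiceType) (P : set I) (F : I -> U)
    (D : set U) :
  D 0 -> (forall x y, D x -> D y -> D (x + y)) ->
  (forall i, P i -> D (F i)) -> D (\sum_(i \in P) F i).
Proof.
move=> D0 DD DF; rewrite big_seq; elim/big_ind: _ => // i.
by case: finite_supportP => // X XP _ _ /XP/DF.
Qed.

End Closed.

(** * Operations in a C*-algebra *)

Section CStarTheory.
Context (R : realType) (A : cstar_algebra R).
Implicit Types a b c : A.

Lemma cmul0r a : 0 ⋅ a = 0.
Proof. by have := cmulPl (-1) 0 0 a; rewrite scaler0 addr0 scaleN1r addNr. Qed.

Lemma cmulr0 a : a ⋅ 0 = 0.
Proof. by have := cmulPr (-1) 0 0 a; rewrite scaler0 addr0 scaleN1r addNr. Qed.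

Lemma cmulBl a b c : (a - b) ⋅ c = a ⋅ c - b ⋅ c.
Proof. by have := cmulPl (-1) b a c; rewrite !scaleN1r addrC [RHS]addrC. Qed.

Lemma cmulBr a b c : c ⋅ (a - b) = c ⋅ a - c ⋅ b.
Proof. by have := cmulPr (-1) b a c; rewrite !scaleN1r addrC [RHS]addrC. Qed.

Lemma cstarB a b : (a - b)^† = a^† - b^†.
Proof.
by have := cstarP (-1) b a; rewrite rmorphN rmorph1 !scaleN1r addrC [RHS]addrC.
Qed.

Lemma cstar_norm_eq a : `|a^†| = `|a|.
Proof.
suff le b : `|b| <= `|b^†|.
  by apply/eqP; rewrite eq_le le andbT -{2}[a]cstarK le.
have [->|b0] := eqVneq b 0; first by rewrite normr0.
have b_gt0 : 0 < `|b| by rewrite normr_gt0.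
by rewrite -(ler_pM2r b_gt0) -expr2 -cstar_norm cmul_norm.
Qed.

End CStarTheory.

(** * The ideal of elements that annihilate the absolute sources *)

Section AbsoluteSourceIdeal.
Local Open Scope classical_set_scope.
Local Open Scope ring_scope.
Context (R : realType) (k : nat) (V L : countType) (G : kgraph k V L).
Context (A : cstar_algebra R) (t : L -> A) (tT : toeplitz_algebra G t).

Let tF : toeplitz_family G t := ta_family tT.

Lemma vertex_mul v l :
  t (idp G v) ⋅ t l = if rng G l == v then t l else 0.
Proof.
have tl : t (idp G (rng G l)) ⋅ t l = t l.
  by rewrite (tf_mul tF) ?src_idp // comp_idl.
case: eqP => [<- //|lv]; rewrite -tl cmulA (tf_orthogonal tF) ?cmul0r //.
by move=> vl; apply: lv.
Qed.

Lemma toeplitz_mul m l :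
  t m ⋅ t l = if src G m == rng G l then t (Defs.comp G m l) else 0.
Proof.
case: eqP => [ml|ml]; first by rewrite (tf_mul tF).
rewrite -[in LHS](comp_idr G m) -(tf_mul tF) ?rng_idp // -cmulA vertex_mul.
by case: eqP => [lm|]; rewrite ?cmulr0 //; case: ml.
Qed.

(** Below a path [l] that ends at an absolute source the relation for
    [t_n^* t_l] leaves only paths that end at the same source. *)
Lemma star_mul_absolute_source n l (D : set A) :
  absolute_source G (src G l) -> D 0 ->
  (forall x y, D x -> D y -> D (x + y)) ->
  (forall m, src G m = src G l -> src G n = rng G m ->
    l = Defs.comp G n m -> D (t m)) ->
  D ((t n)^† ⋅ t l).
Proof.
move=> av D0 DD Dt; rewrite (tf_min tF); apply: fsbig_closed => // x lx.
have [x2 lE] := Lmin_absolute_source av lx.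
have [_ nx _ _ _] := lx.
have sx : src G x.1 = src G l by rewrite [in RHS]lE src_comp.
rewrite x2 (tf_projection tF _).2 -sx (tf_mul tF) ?rng_idp // comp_idr.
exact: Dt.
Qed.

Lemma gap_factor_mul v e l : absolute_source G (src G l) ->
  rng G l = v -> (t (idp G v) - t e ⋅ (t e)^†) ⋅ t l =
                 if `[< starts_with G e l >] then 0 else t l.
Proof.
move=> av lv; rewrite cmulBl vertex_mul lv eqxx.
case: asboolP => [[l' el ->]|nel].
  by rewrite -(tf_mul tF) // cmulA (tf_partial_isometry tF) subrr.
rewrite -cmulA; suff -> : (t e)^† ⋅ t l = 0 by rewrite cmulr0 subr0.
apply: (@star_mul_absolute_source e l [set 0]) => //= [x y -> ->|m _ em lE].
  by rewrite addr0.
by case: nel; exists m.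
Qed.

(** Each factor of the gap projection either fixes [t_l] or kills it, so that
    the order of the factors does not matter. *)
Lemma gap_projection_mul v E l : absolute_source G (src G l) ->
  gap_projection G t v E ⋅ t l =
  if (rng G l == v) && ~~ has (fun e => `[< starts_with G e l >]) E
  then t l else 0.
Proof.
move=> av; elim: E => [|e E IH]; first by rewrite vertex_mul andbT.
rewrite /= -cmulA -/(gap_projection G t v E) IH negb_or.
have [lv /=|_] := eqVneq; last by rewrite cmulr0.
case: hasP => _ /=; first by rewrite cmulr0 andbF.
by rewrite gap_factor_mul // andbT if_neg.
Qed.

(** Encoding the closed span as the smallest closed subspace gives a direct
    induction principle, without finite combinations and their limits. *)
Definition absolute_source_span : set A :=
  [set x | forall D : set A, D 0 ->
     (forall (z : R[i]) a b, D a -> D b -> D (z *: a + b)) -> closed D ->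
     (forall l, absolute_source G (src G l) -> D (t l)) -> D x].

Let K := absolute_source_span.

Lemma span_gen l : absolute_source G (src G l) -> K (t l).
Proof. by move=> av D _ _ _; apply. Qed.

Lemma span0 : K 0. Proof. by []. Qed.

Lemma spanP (z : R[i]) x y : K x -> K y -> K (z *: x + y).
Proof.
move=> Kx Ky D D0 DP Dc Dg.
by apply: (DP); [exact: (Kx D)|exact: (Ky D)].
Qed.

Lemma span_closed : closed K.
Proof.
rewrite [K](_ : _ = \bigcap_(D in [set D : set A |
    [/\ D 0, forall (z : R[i]) a b, D a -> D b -> D (z *: a + b), closed D
      & forall l, absolute_source G (src G l) -> D (t l)]]) D).
  by apply: closed_bigI => D [].
apply/seteqP; split=> [x Kx D [? ? ? ?]|x Kx D ? ? ? ?].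
  by apply: (Kx D).
by apply: (Kx D).
Qed.

(** [x |-> b x] is continuous, so it suffices to look at the generators. *)
Lemma span_mull b (D : set A) : D 0 ->
  (forall (z : R[i]) x y, D x -> D y -> D (z *: x + y)) -> closed D ->
  (forall l, absolute_source G (src G l) -> D (b ⋅ t l)) ->
  forall x, K x -> D (b ⋅ x).
Proof.
move=> D0 DP Dc Dg x Kx; apply: (Kx [set y | D (b ⋅ y)]) => //=.
- by rewrite cmulr0.
- by move=> z y y' Dy Dy'; rewrite cmulPr; exact: DP.
- apply: (preimage_closed_bounded (normr_ge0 b) _ _ Dc) => [y y'|y].
    exact: cmulBr.
  exact: cmul_norm.
Qed.

(** The left multipliers of the span whose adjoints are also left multipliers
    form a closed *-subalgebra that contains the generators. *)
Lemma span_ideal b x : K x -> K (b ⋅ x).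
Proof.
pose M := [set b : A | forall x, K x -> K (b ⋅ x)].
have MP (z : R[i]) a c : M a -> M c -> M (z *: a + c).
  by move=> Ma Mc y Ky; rewrite cmulPl; apply: spanP; [exact: Ma|exact: Mc].
have M0 : M 0 by move=> y _; rewrite cmul0r; exact: span0.
have MM a c : M a -> M c -> M (a ⋅ c).
  by move=> Ma Mc y Ky; rewrite -cmulA; apply: Ma; exact: Mc.
have Mc : closed M.
  rewrite [M](_ : _ = \bigcap_(y in K) [set a : A | K (a ⋅ y)]); last first.
    by apply/seteqP; split=> a Ma y Ky; exact: Ma.
  apply: closed_bigI => y _.
  apply: (preimage_closed_bounded (normr_ge0 y) _ _ span_closed) => [a c|a].
    exact: cmulBl.
  by rewrite mulrC cmul_norm.
suff Mt : M `&` [set b | M b^†] = setT.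
  have [Mb _] : (M `&` [set b | M b^†]) b by rewrite Mt.
  exact: Mb.
apply: (ta_generated tT).
  split=> [|z a c [a1 a2] [c1 c2]|a c [a1 a2] [c1 c2]|a [a1 a2]|].
  - split=> //=; have := cstarB (0 : A) 0; rewrite !subrr => ->; exact: M0.
  - by split; [exact: MP|rewrite /= cstarP; exact: MP].
  - by split; [exact: MM|rewrite /= cstarM; exact: MM].
  - by split => //=; rewrite cstarK.
  - apply: closedI => //.
    apply: (preimage_closed_bounded ler01 _ _ Mc) => [a c|a].
      exact: cstarB.
    by rewrite mul1r cstar_norm_eq.
move=> _ [n _ <-]; split => y Ky.
  apply: span_mull Ky => [|||l av];
    [exact: span0|exact: spanP|exact: span_closed|].
  rewrite toeplitz_mul; case: eqP => [nl|_]; last exact: span0.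
  by apply: span_gen; rewrite src_comp.
apply: span_mull Ky => [|||l av];
  [exact: span0|exact: spanP|exact: span_closed|].
apply: star_mul_absolute_source => // [y1 y2 K1 K2|m ml _ _].
  by rewrite -[y1]scale1r; exact: spanP.
by apply: span_gen; rewrite ml.
Qed.

(** The left annihilator of the left ideal [K] is a closed two-sided ideal. It
    contains the gap projection of an exhaustive set, as such a set contains an
    initial edge of each path from [v] to an absolute source. *)
Lemma graph_ideal_absolute_source a l :
  graph_ideal G t a -> absolute_source G (src G l) -> a ⋅ t l = 0.
Proof.
move=> Ja av.
suff : [set a : A | forall x, K x -> a ⋅ x = 0] a by apply; exact: span_gen.
apply: Ja => [|_ [v [E [E0 Eex ->]]]] /=.
  split=> [x _|z b c Jb Jc x Kx|b c Jb x Kx|b c Jb x Kx|].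
  - exact: cmul0r.
  - by rewrite cmulPl Jb // Jc // scaler0 addr0.
  - by rewrite -cmulA Jb // cmulr0.
  - by rewrite -cmulA Jb //; exact: span_ideal.
  - rewrite [X in closed X](_ : _ = \bigcap_(y in K) [set b : A | b ⋅ y = 0]);
      last first.
      by apply/seteqP; split=> b Jb x Kx; exact: Jb.
    apply: closed_bigI => y _.
    apply: (closed_preimage0_bounded (normr_ge0 y)) => [b c|b].
      exact: cmulBl.
    by rewrite mulrC cmul_norm.
move=> x; apply: (@span_mull _ [set 0]) => [|z y y' /= -> ->||m mav] //=.
- by rewrite scaler0 addr0.
- exact/accessible_closed_set1/hausdorff_accessible/norm_hausdorff.
rewrite gap_projection_mul //; case: ifP => // /andP[/eqP mv /hasPn Em].
have [e eE em] := starts_with_edge_absolute_source mav Eex E0 mv.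
by have := Em e eE => /asboolPn.
Qed.

End AbsoluteSourceIdeal.

(** * The finite-path representation *)

Section Hilbert.
Local Open Scope classical_set_scope.
Local Open Scope ring_scope.
Context (R : realType) (H : completeNormedModType R[i]).
Context (ip : {dot H for (@Num.conj R[i])}) (hH : is_hilbert ip).

Lemma ipBr w x y : ip w (x - y) = ip w x - ip w y.
Proof. exact: linearBr. Qed.

Lemma ipBl w x y : ip (x - y) w = ip x w - ip y w.
Proof. exact: linearBl. Qed.

(** The Cauchy-Schwarz inequality, from the square of the norm of
    [(w | w) x - (x | w) w]. *)
Lemma ip_bounded w x : `|ip w x| <= `|w| * `|x|.
Proof.
have [->|w0] := eqVneq w 0; first by rewrite linear0l normr0 mulr_ge0.
have ww : 0 < ip w w by exact: neq0_dnorm_gt0.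
have wR : (ip w w)^* = ip w w by apply/CrealP/ger0_real/ltW.
rewrite -(@ler_pXn2r _ 2) ?nnegrE ?mulr_ge0 // exprMn !hH.
rewrite -(ler_pM2l ww) -subr_ge0.
set u := ip w w *: x - ip x w *: w.
suff -> : ip w w * (ip w w * ip x x) - ip w w * `|ip w x| ^+ 2 = ip u u.
  by rewrite -hH exprn_ge0.
have xw : ip x w = (ip w x)^*.
  by rewrite (@hermC _ _ _ _ ip x w) /= expr0 mul1r.
rewrite /u !(linearBl, linearBr) /= !(linearZl_LR, linearZr_LR) /=.
rewrite normCK xw wR conjCK.
rewrite -![_ *: _]/(_ * _).
by ring.
Qed.

(** A vector orthogonal to the basis is orthogonal to the closed subspace
    that the basis generates, hence to itself. *)
Lemma orthonormal_basis_eq (I : choiceType) (h : I -> H) (x y : H) :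
  orthonormal_basis ip h -> (forall i, ip x (h i) = ip y (h i)) -> x = y.
Proof.
move=> [_ htot] xy; apply/eqP; rewrite -subr_eq0 -(dnorm_eq0 ip).
set w := x - y.
suff wT : [set z | ip w z = 0] = setT.
  by have -> : ip w w = 0 by rewrite -[_ = 0]/([set z | ip w z = 0] w) wT.
apply: htot; last by move=> _ [i _ <-] /=; rewrite ipBl xy subrr.
split=> [|a b c /= b0 c0|]; first exact: linear0r.
  by rewrite linearDr /= linearZr_LR /= b0 c0 mulr0 addr0.
apply: (@closed_preimage0_bounded R[i] H R[i]^o _ `|w|) => // [b c|b].
  exact: ipBr.
exact: ip_bounded.
Qed.

End Hilbert.

Section Representation.
Local Open Scope classical_set_scope.
Local Open Scope ring_scope.
Context (R : realType) (k : nat) (V L : countType) (G : kgraph k V L).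
Context (A : cstar_algebra R) (t : L -> A).
Context (H : completeNormedModType R[i]) (ip : {dot H for (@Num.conj R[i])}).
Context (hH : is_hilbert ip) (h : L -> H) (hB : orthonormal_basis ip h).
Context (pi : A -> H -> H) (piR : finite_path_representation ip G h t pi).

Let rep : representation ip pi := piR.1.

Lemma rep0l x : pi 0 x = 0.
Proof.
by have := rep_linear rep (-1) 0 0 x; rewrite scaler0 addr0 scaleN1r addNr.
Qed.

Lemma rep0r a : pi a 0 = 0.
Proof.
by have := rep_operator rep a (-1) 0 0; rewrite scaler0 addr0 scaleN1r addNr.
Qed.

Lemma repBl a b x : pi (a - b) x = pi a x - pi b x.
Proof.
by have := rep_linear rep (-1) b a x; rewrite !scaleN1r addrC [RHS]addrC.
Qed.

Lemma rep_star_comp m l' : src G m = rng G l' ->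
  pi (t m)^† (h (Defs.comp G m l')) = h l'.
Proof.
move=> ml'; apply: (orthonormal_basis_eq hH hB) => i.
rewrite (rep_star rep) piR.2 hB.1; case: eqP => [mi|mi].
  rewrite hB.1; congr (_%:R); congr nat_of_bool.
  by apply/eqP/eqP => [/(comp_injr ml' mi)|->].
by rewrite linear0r; case: eqP => // li; case: mi; rewrite -li.
Qed.

Lemma rep_star_notin m l : ~ starts_with G m l -> pi (t m)^† (h l) = 0.
Proof.
move=> ml; apply: (orthonormal_basis_eq hH hB) => i.
rewrite (rep_star rep) piR.2 linear0l.
case: eqP => [mi|_]; last exact: linear0r.
by rewrite hB.1; case: eqP => // lE; case: ml; exists i.
Qed.

Lemma rep_range_projection e l :
  pi (t e ⋅ (t e)^†) (h l) = if `[< starts_with G e l >] then h l else 0.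
Proof.
rewrite (rep_mul rep); case: asboolP => [[l' el ->]|/rep_star_notin ->].
  by rewrite rep_star_comp // piR.2 el eqxx.
exact: rep0r.
Qed.

(** All the [t_e t_e^*] are diagonal in the basis [h], with entries 0 and 1. *)
Lemma rep_gap_projection v E l :
  pi (gap_projection G t v E) (h l) =
  if (rng G l == v) && ~~ has (fun e => `[< starts_with G e l >]) E
  then h l else 0.
Proof.
elim: E => [|e E IH].
  rewrite /= piR.2 src_idp eq_sym andbT.
  by case: eqP => // <-; rewrite comp_idl.
rewrite /= (rep_mul rep) -/(gap_projection G t v E) IH negb_or.
have [lv /=|_] := eqVneq; last by rewrite rep0r.
case: hasP => _ /=; first by rewrite rep0r andbF.
rewrite andbT repBl rep_range_projection piR.2 src_idp lv eqxx -lv comp_idl.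
by case: asboolP => _; rewrite ?subrr ?subr0.
Qed.

(** Every basis vector comes from a vertex, which moves a question about
    [pi a h_l] into the algebra. *)
Lemma rep_path a l : pi a (h l) = pi (a ⋅ t l) (h (idp G (src G l))).
Proof. by rewrite (rep_mul rep) piR.2 rng_idp eqxx comp_idr. Qed.

End Representation.

(** * Sums of weights over the paths *)

Section Sums.
Local Open Scope classical_set_scope.
Local Open Scope ring_scope.
Local Open Scope complex_scope.
Local Existing Instance summability.totally_filter.

(** Partial sums of nonnegative terms increase along the finite subsets, so a
    bounded family converges to the supremum of its partial sums. *)
Lemma sum_nneg_sup (R : realType) (I : choiceType) (f : I -> R) (M : R) :
  (forall i, 0 <= f i) -> (forall F : {fset I}, \sum_(i <- F) f i <= M) ->
  @summability.sum I R[i] R[i]^o (fun i => (f i)%:C) =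
  (sup (range (fun F : {fset I} => \sum_(i <- F) f i)))%:C.
Proof.
move=> f0 fM; set E := range _.
have supE : has_sup E.
  split; first by exists (\sum_(i <- fset0) f i), fset0.
  by exists M => _ [F _ <-]; exact: fM.
have ps F : summability.partial_sum (fun i => (f i)%:C : R[i]^o) F =
            (\sum_(i <- F) f i)%:C.
  by rewrite /summability.partial_sum rmorph_sum /= big_seq_fsetE.
apply: cvg_lim; first exact: (@norm_hausdorff R[i] R[i]^o).
apply/(@cvgrPdist_lt R[i] R[i]^o) => e e0.
have [eps eps0 ->] : exists2 d : R, 0 < d & e = d%:C.
  case: e e0 => a b; rewrite ltcE /= => /andP[/eqP -> a0].
  by exists a.
have [_ [F0 _ <-] ltF0] := sup_adherent eps0 supE.
exists F0 => // F /= F0F; rewrite ps -rmorphB /= normc_def /= expr0n addr0.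
rewrite sqrtr_sqr ltcR ger0_norm; last first.
  by rewrite subr_ge0; apply: ub_le_sup; [exact: supE.2|exists F].
rewrite ltrBlDr -ltrBlDl; apply: lt_le_trans ltF0 _.
have -> : \sum_(j <- F0) f j = \sum_(j <- F) (if j \in F0 then f j else 0).
  rewrite -(@big_fset_incl _ _ _ _ F0 F) // => [|j _ /negbTE -> //].
  by apply: eq_big_seq => j ->.
by apply: ler_sum => j _; case: ifP.
Qed.

Lemma sum_nneg_eq0 (R : realType) (I : choiceType) (f : I -> R) (M : R) :
  (forall i, 0 <= f i) -> (forall F : {fset I}, \sum_(i <- F) f i <= M) ->
  @summability.sum I R[i] R[i]^o (fun i => (f i)%:C) = 0 -> forall i, f i = 0.
Proof.
move=> f0 fM; rewrite (sum_nneg_sup f0 fM) => -[s0] i.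
apply/le_anti/andP; split=> //.
rewrite -s0 -(big_seq_fset1 +%R i f).
apply: ub_le_sup; last by exists [fset i]%fset.
by exists M => _ [F _ <-]; exact: fM.
Qed.

Lemma sum_fun0 (R : realType) (I : choiceType) (f : I -> R[i]) :
  (forall i, f i = 0) -> @summability.sum I R[i] R[i]^o f = 0.
Proof.
move=> f0; apply: cvg_lim; first exact: (@norm_hausdorff R[i] R[i]^o).
rewrite (_ : summability.partial_sum _ = cst 0); first exact: cvg_cst.
by apply/funext => F; rewrite /summability.partial_sum big1.
Qed.

(** Grouped by sources, all the weights together sum to [eps . y^beta = 1]. *)
Lemma Sigma_beta_sum (R : realType) (k : nat) (V : finType) (L : countType)
    (G : kgraph k V L) (r : 'I_k -> R) (beta : R) (eps : V -> R)
    (F : {fset L}) :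
  Sigma_beta G r beta eps ->
  \sum_(l <- F) boltzmann G r beta l * eps (src G l) <= 1.
Proof.
move=> [eps0 eps1]; rewrite -lee_fin -eps1.
rewrite (partition_big (src G) predT) //= -sumEFin.
apply: lee_sum => v _.
rewrite (eq_bigr (fun l => eps v * boltzmann G r beta l)); last first.
  by move=> l /eqP ->; rewrite mulrC.
rewrite -mulr_sumr EFinM; apply: lee_wpmul2l; first by rewrite lee_fin.
rewrite -big_filter -sumEFin; apply: esum_ge.
exists [set` [seq l <- F | src G l == v]].
  split; first exact: finite_seq.
  by move=> l /=; rewrite mem_filter => /andP[/eqP].
by rewrite -fsbig_seq // filter_uniq.
Qed.

End Sums.

(** * Factorization through the graph algebra *)

Theorem proposition8p2 (R : realType) (k : nat) (V : finType) (L : countType)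
    (G : kgraph k V L) (Gfin : finite_kgraph G)
    (r : 'I_k -> R) (r_gt0 : forall i, 0 < r i) (beta : R)
    (beta_gt : forall i,
       (lne (spectral_radius (vertex_matrix R G i))%:E < (beta * r i)%:E)%E)
    (A : cstar_algebra R) (t : L -> A) (A_toeplitz : toeplitz_algebra G t)
    (H : completeNormedModType R[i]) (ip : {dot H for (@Num.conj R[i])})
    (H_hilbert : is_hilbert ip) (h : L -> H) (h_basis : orthonormal_basis ip h)
    (pi : A -> H -> H) (pi_rep : finite_path_representation ip G h t pi)
    (eps : V -> R) (eps_Sigma : Sigma_beta G r beta eps) :
  factors_through_graph_algebra G t (phi_state G r beta ip h pi eps) <->
  (forall v, eps v != 0 -> absolute_source G v).
Proof.
have eps0 := eps_Sigma.1.
split=> [phi0 v epsv|eps_supp a Ja]; last first.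
  apply: sum_fun0 => l.
  have [->|/eps_supp av] := eqVneq (eps (src G l)) 0.
    by rewrite mulr0 mul0r.
  rewrite (rep_path pi_rep) (graph_ideal_absolute_source A_toeplitz Ja av).
  by rewrite (rep0l pi_rep) linear0l mulr0.
apply/absolute_sourceP => l lv.
(* a nontrivial path from v starts with an edge, so that the edges at v are a
   nonempty exhaustive set *)
apply/eqP/negPn/negP => lN.
pose E := finmap.enum_fset (fset_set (edges G v)).
have EE : [set` E]%classic = edges G v.
  by rewrite -[RHS]fset_setK //; exact: finite_edges.
have E0 : E != [::].
  have [|e + _] := @starts_with_edge _ _ _ G l.
    by apply: contra_neq lN => /deg0_idp ->; rewrite lv.
  by rewrite lv -EE /= => eE; apply: contraTneq eE => ->.
pose b l := (rng G l == v) && ~~ has (fun e => `[< starts_with G e l >]) E.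
pose f l := boltzmann G r beta l * eps (src G l) * (b l)%:R.
have bw0 m : 0 <= boltzmann G r beta m * eps (src G m).
  by rewrite mulr_ge0 // expR_ge0.
have f0 m : 0 <= f m by rewrite mulr_ge0.
have fM (F : {fset L}) : \sum_(m <- F) f m <= 1.
  apply: le_trans (Sigma_beta_sum F eps_Sigma).
  apply: ler_sum => m _; rewrite /f; case: (b m); rewrite ?mulr1 // mulr0 //.
have : phi_state G r beta ip h pi eps (gap_projection G t v E) = 0.
  apply: phi0 => J _; apply; exists v, E; split=> //.
  exact: exhaustive_edges.
rewrite /phi_state.
have -> : (fun m => (boltzmann G r beta m * eps (src G m))%:C%C *
    ip (pi (gap_projection G t v E) (h m)) (h m)) = (fun m => (f m)%:C%C).
  apply/funext => m; rewrite (rep_gap_projection H_hilbert h_basis pi_rep).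
  rewrite -/(b m) /f; case: (b m); first by rewrite h_basis.1 eqxx !mulr1.
  by rewrite linear0l !mulr0.
move=> /(sum_nneg_eq0 f0 fM)/(_ (idp G v)).
have bv : b (idp G v).
  rewrite /b rng_idp eqxx; apply/hasPn => e eE; apply/asboolPn => -[e' ee' ve].
  have [_ [i ei]] : edges G v e by rewrite -EE.
  have := congr1 (deg G) ve; rewrite deg_idp deg_comp // ei => /ffunP/(_ i).
  by rewrite !ffunE eqxx.
rewrite /f bv mulr1 src_idp => /eqP; rewrite mulf_eq0 (negbTE epsv) orbF.
by rewrite gt_eqF // expR_gt0.
Qed.
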